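(* Let $R$ be an unramified regular local ring of mixed characteristic $p>0$, and let $S$ be any ramified regular local ring obtained from $R$ via an Eisenstein extension. Let $I$ be an ideal of $R$. Let $i\geq 0$ be any integer and assume that $p\notin \operatorname{Ass}_{\mathbb Z} H^{i}_I(R) \cup \operatorname{Ass}_{\mathbb Z} H^{i+1}_{I}(R)$. Then, for every ideal $J\subset S$ such that $\operatorname{rad}(J+pS)= \operatorname{rad}(IS+pS)$, the Bockstein homomorphism $\beta^{i-1}_{p,J}: H^{i-1}_J(S/pS)\rightarrow H^{i}_J(S/pS)$ is zero.
   Context: $H^i_I(-)$ denotes the $i$-th local cohomology with support in $I$ (zero for negative $i$). For a prime integer $p$ and an abelian group $M$, ''$p\notin\operatorname{Ass}_{\mathbb Z}M$'' means that $p\mathbb Z$ is not an associated prime of $M$ as a $\mathbb Z$-module (equivalently, multiplication by $p$ on $M$ is injective). A Noetherian local ring $(R,\mathfrak m,K)$ of mixed characteristic with residue field $K$ of characteristic $p$ is called unramified if $p\notin \mathfrak m^2$ and ramified if $p\in\mathfrak m^2$. For a normal local ring $(R,\mathfrak m)$, an Eisenstein polynomial is a monic polynomial $f(X)=X^d+a_1X^{d-1}+\cdots+a_d\in R[X]$ with $d\ge 1$, $a_j\in\mathfrak m$ for all $1\le j\le d$, and $a_d\notin\mathfrak m^2$; the local ring $S=R[X]/(f(X))$ is called an Eisenstein extension of $R$. The ideal $IS$ is the extension of $I$ along $R\to S$. Bockstein homomorphism: for a Noetherian ring $A$, an ideal $J\subset A$ and a nonzerodivisor $u\in A$, the short exact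 sequence $0\to A\xrightarrow{u}A\to A/uA\to 0$ induces a long exact sequence $$\cdots\to H^{i-1}_{J}(A/uA)\xrightarrow{\delta^{i-1}_{u,J}} H^{i}_{J}(A)\xrightarrow{u}H^{i}_{J}(A)\xrightarrow{\pi^i_{u,J}} H^{i}_{J}(A/uA) \to\cdots,$$ and $\beta^{i-1}_{u,J}:=\pi^i_{u,J}\circ\delta^{i-1}_{u,J}: H^{i-1}_J(A/uA)\to H^i_J(A/uA)$. Here $A=S$, $u=p$. *)

(* Defs.v *)
From HB Require Import structures.
From mathcomp Require Import all_boot all_order all_algebra.
From mathcomp Require Import boolp classical_sets.

Set Implicit Arguments.
Unset Strict Implicit.
Unset Printing Implicit Defensive.

Import GRing.Theory.
Local Open Scope classical_set_scope.
Local Open Scope ring_scope.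

(* Ideals are Prop-valued sets, and the unit ideal is allowed: MathComp's
   [idealr] is boolean and restricted to proper ideals. *)

Section Ideals.
Variable A : comNzRingType.

Definition is_ideal (I : set A) : Prop :=
  I 0 /\ forall a x y, I x -> I y -> I (a * x + y).

Definition ideal_gen (X : set A) : set A := smallest is_ideal X.

Definition ideal_add (I J : set A) : set A := ideal_gen (I `|` J).

Definition ideal_exp (I : set A) (n : nat) : set A :=
  ideal_gen [set \prod_(j < n) a j | a in [set a : 'I_n -> A | forall j, I (a j)]].

Definition radical (I : set A) : set A := [set x | exists n : nat, I (x ^+ n)].

Definition prime_ideal (P : set A) : Prop :=
  [/\ is_ideal P, ~ P 1 & forall x y, P (x * y) -> P x \/ P y].

Definition maximal_ideal (m : set A) : Prop :=
  [/\ is_ideal m, ~ m 1 &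
      forall I, is_ideal I -> m `<=` I -> ~ I 1 -> I = m].

Definition noetherian : Prop :=
  forall I, is_ideal I -> exists n (a : 'I_n -> A), I = ideal_gen (range a).

Definition local_ring (m : set A) : Prop :=
  maximal_ideal m /\ forall m', maximal_ideal m' -> m' = m.

Definition prime_chain (d : nat) : Prop :=
  exists P : nat -> set A,
    (forall j, (j <= d)%N -> prime_ideal (P j)) /\
    (forall j, (j < d)%N -> P j `<` P j.+1).

Definition krull_dim (d : nat) : Prop :=
  prime_chain d /\ forall e, prime_chain e -> (e <= d)%N.

Definition regular_local (m : set A) : Prop :=
  [/\ noetherian, local_ring m &
      exists d, krull_dim d /\ exists a : 'I_d -> A, m = ideal_gen (range a)].

Definition mixed_char (m : set A) (p : nat) : Prop :=
  [/\ forall k : nat, k%:R = 0 :> A -> k = 0%N, prime p & m p%:R].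

Definition unramified (m : set A) (p : nat) : Prop :=
  mixed_char m p /\ ~ ideal_exp m 2 p%:R.

Definition ramified (m : set A) (p : nat) : Prop :=
  mixed_char m p /\ ideal_exp m 2 p%:R.

(* f = X^d + a_1 X^(d-1) + ... + a_d with d = (size f).-1 and a_j = f`_(d - j). *)
Definition eisenstein (m : set A) (f : {poly A}) : Prop :=
  [/\ f \is monic, (1 < size f)%N,
      forall j, (j < (size f).-1)%N -> m f`_j & ~ ideal_exp m 2 f`_0].

End Ideals.

(* For f monic of positive degree, {poly %/ f} is the ring A[X]/(f), and
   qpolyC f : A -> {poly %/ f} is its structure morphism. *)
Definition ideal_extension (A : comNzRingType) (f : {poly A}) (I : set A) :
  set {poly %/ f} := ideal_gen [set qpolyC f x | x in I].

Definition AssZ (M : zmodType) : set (set int) :=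
  [set P | prime_ideal P /\ exists x : M, P = [set k : int | x *~ k = 0]].

Definition pZ (p : nat) : set int := [set k : int | (p %| k)%Z].

Section SubQuot.
Variables (A : comNzRingType) (V : lmodType A).

Record submodule : Type := Submodule {
  submodule_set :> V -> Prop;
  submodule0 : submodule_set 0;
  submoduleP : forall a x y,
    submodule_set x -> submodule_set y -> submodule_set (a *: x + y) }.

Variable N : submodule.

Definition submod_pred : {pred V} := fun x => `[< N x >].

Fact submod_pred_closed : subsemimod_closed submod_pred.
Proof.
apply: GRing.submod_closed_semi; split; first exact/asboolP/submodule0.
by move=> a x y /asboolP Nx /asboolP Ny; apply/asboolP/submoduleP.
Qed.

HB.instance Definition _ :=
  GRing.isSubmodClosed.Build A V submod_pred submod_pred_closed.

Record submod : predArgType :=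
  Submod { submod_val : V; _ : submod_val \in submod_pred }.

HB.instance Definition _ := [isSub for submod_val].
HB.instance Definition _ := [Choice of submod by <:].
HB.instance Definition _ := [SubChoice_isSubLmodule of submod by <:].

Definition quotmod : Type := Quotient.quot submod_pred.

HB.instance Definition _ := GRing.Zmodule.on quotmod.

Definition quot_pi (x : V) : quotmod := \pi_(Quotient.quot submod_pred)%qT x.
Definition quot_repr (x : quotmod) : V := repr (x : Quotient.quot submod_pred).

Lemma quot_reprK x : quot_pi (quot_repr x) = x.
Proof. exact: reprK. Qed.

Lemma quot_piP x y : quot_pi x = quot_pi y <-> N (x - y).
Proof.
split=> [/eqP|h]; last apply/eqP.
  by rewrite /quot_pi -Quotient.idealrBE => /asboolP.
by rewrite /quot_pi -Quotient.idealrBE; apply/asboolP.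
Qed.

Lemma quot_piD x y : quot_pi (x + y) = quot_pi x + quot_pi y.
Proof. exact: (raddfD (\pi_(Quotient.quot submod_pred)%qT)). Qed.

Definition quot_scale (a : A) (x : quotmod) := quot_pi (a *: quot_repr x).

Lemma quot_piZ a x : quot_pi (a *: x) = quot_scale a (quot_pi x).
Proof.
apply/quot_piP; rewrite -scalerBr -[_ *: _]addr0.
apply: submoduleP (submodule0 N); apply/quot_piP.
by rewrite quot_reprK.
Qed.

Fact quot_scaleA a b x : quot_scale a (quot_scale b x) = quot_scale (a * b) x.
Proof.
by rewrite -[x]quot_reprK -!quot_piZ scalerA.
Qed.

Fact quot_scale1 : left_id 1 quot_scale.
Proof. by move=> x; rewrite -[x]quot_reprK -!quot_piZ scale1r. Qed.

Fact quot_scaleDr : right_distributive quot_scale +%R.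
Proof.
move=> a x y; rewrite -[x]quot_reprK -[y]quot_reprK.
by rewrite -quot_piD -!quot_piZ scalerDr quot_piD.
Qed.

Fact quot_scaleDl x : {morph quot_scale^~ x : a b / a + b}.
Proof.
by move=> a b; rewrite -[x]quot_reprK -!quot_piZ scalerDl quot_piD.
Qed.

HB.instance Definition _ := GRing.Zmodule_isLmodule.Build A quotmod
  quot_scaleA quot_scale1 quot_scaleDr quot_scaleDl.

Fact quot_pi_linear : linear quot_pi.
Proof. by move=> a x y; rewrite quot_piD quot_piZ. Qed.

HB.instance Definition _ :=
  GRing.isLinear.Build A V quotmod _ quot_pi quot_pi_linear.

End SubQuot.

Section LinearTools.
Variables (A : comNzRingType) (U V W : lmodType A).

Definition mk_linear (f : U -> V) (h : linear f) : {linear U -> V} :=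
  HB.pack_for {linear U -> V} f (GRing.isLinear.Build A U V _ f h).

Fact ker_subproof (f : {linear U -> V}) a x y :
  f x = 0 -> f y = 0 -> f (a *: x + y) = 0.
Proof. by move=> fx fy; rewrite linearP fx fy scaler0 addr0. Qed.

Definition ker (f : {linear U -> V}) : submodule U :=
  @Submodule A U [set x | f x = 0] (linear0 f) (@ker_subproof f).

Fact im_subproof (f : {linear U -> V}) a x y :
  range f x -> range f y -> range f (a *: x + y).
Proof.
by move=> [u _ <-] [v _ <-]; exists (a *: u + v) => //; rewrite linearP.
Qed.

Definition im (f : {linear U -> V}) : submodule V :=
  @Submodule A V (range f) (ex_intro2 _ _ 0 I (linear0 f)) (@im_subproof f).

Fact preim_subproof (f : {linear U -> V}) (N : submodule V) a x y :
  N (f x) -> N (f y) -> N (f (a *: x + y)).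
Proof. by move=> Nx Ny; rewrite linearP; apply: submoduleP. Qed.

Fact preim0_subproof (f : {linear U -> V}) (N : submodule V) : N (f 0).
Proof. by rewrite linear0; apply: submodule0. Qed.

Definition preim (f : {linear U -> V}) (N : submodule V) : submodule U :=
  @Submodule A U [set x | N (f x)] (preim0_subproof f N)
    (@preim_subproof f N).

Fact zero_subproof a (x y : U) : x = 0 -> y = 0 -> a *: x + y = 0.
Proof. by move=> -> ->; rewrite scaler0 addr0. Qed.

Definition zero_submodule : submodule U :=
  @Submodule A U [set x | x = 0] erefl zero_subproof.

Definition short_exact (f : {linear U -> V}) (g : {linear V -> W}) : Prop :=
  [/\ injective f, forall z, exists y, g y = z &
      forall y, g y = 0 <-> exists x, f x = y].

Definition injective_module (E : lmodType A) : Prop :=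
  forall (X Y : lmodType A) (f : {linear X -> Y}) (g : {linear X -> E}),
    injective f -> exists h : {linear Y -> E}, forall x, h (f x) = g x.

End LinearTools.

Section SubQuotMaps.
Variables (A : comNzRingType) (V W : lmodType A).
Variables (N : submodule V) (P : submodule W) (f : {linear V -> W}).
Hypothesis fNP : forall x, N x -> P (f x).

Lemma submodP (x : submod N) : N (val x).
Proof. by case: x => x /= /asboolP. Qed.

Definition in_submod (x : V) (Nx : N x) : submod N := Submod (asboolT Nx).

Lemma submod_val_linear : linear (@submod_val A V N).
Proof. by []. Qed.

Definition submod_incl : {linear submod N -> V} := mk_linear submod_val_linear.

Fact sub_map_subproof (x : submod N) : f (val x) \in submod_pred P.
Proof. by apply/asboolP/fNP; move: (submodP x). Qed.

Definition sub_map_fun (x : submod N) : submod P := Submod (sub_map_subproof x).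

Fact sub_map_linear : linear sub_map_fun.
Proof. by move=> a x y; apply: val_inj; rewrite /= -linearP. Qed.

Definition sub_map : {linear submod N -> submod P} := mk_linear sub_map_linear.

Definition quot_map_fun (x : quotmod N) : quotmod P :=
  quot_pi P (f (quot_repr x)).

Lemma quot_map_funE x : quot_map_fun (quot_pi N x) = quot_pi P (f x).
Proof.
apply/quot_piP; rewrite -linearB; apply: fNP; apply/quot_piP.
by rewrite quot_reprK.
Qed.

Fact quot_map_linear : linear quot_map_fun.
Proof.
move=> a x y; rewrite -[x]quot_reprK -[y]quot_reprK.
by rewrite -linearP !quot_map_funE !linearP.
Qed.

Definition quot_map : {linear quotmod N -> quotmod P} :=
  mk_linear quot_map_linear.

End SubQuotMaps.

Section Complexes.
Variable A : comNzRingType.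

Record cochain_complex : Type := CochainComplex {
  cochain :> nat -> lmodType A;
  cdiff : forall n, {linear cochain n -> cochain n.+1};
  cdiffK : forall n x, cdiff n.+1 (cdiff n x) = 0 }.

Record cochain_map (K L : cochain_complex) : Type := CochainMap {
  cmap :> forall n, {linear K n -> L n};
  cmapD : forall n x, cmap n.+1 (cdiff K n x) = cdiff L n (cmap n x) }.

Definition cocycles (K : cochain_complex) n : submodule (K n) := ker (cdiff K n).

Definition coboundaries (K : cochain_complex) n : submodule (K n) :=
  match n with
  | 0 => zero_submodule (K 0)
  | n'.+1 => im (cdiff K n')
  end.

Definition cohomology (K : cochain_complex) n : lmodType A :=
  quotmod (preim (submod_incl (cocycles K n)) (coboundaries K n)).

Definition coh_class (K : cochain_complex) n (z : K n)
  (dz : cdiff K n z = 0) : cohomology K n :=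
  quot_pi _ (in_submod (N := cocycles K n) dz).

Section CohMap.
Variables (K L : cochain_complex) (f : cochain_map K L) (n : nat).

Fact cocycles_map x : cocycles K n x -> cocycles L n (f n x).
Proof. by rewrite /= => dx; rewrite -cmapD dx linear0. Qed.

Fact coboundaries_map x : coboundaries K n x -> coboundaries L n (f n x).
Proof.
case: n x => [|k] x /=; first by move->; rewrite linear0.
by move=> [y _ <-]; exists (f k y) => //; rewrite cmapD.
Qed.

Definition coh_map : {linear cohomology K n -> cohomology L n} :=
  @quot_map A _ _ (preim (submod_incl (cocycles K n)) (coboundaries K n))
    (preim (submod_incl (cocycles L n)) (coboundaries L n))
    (sub_map cocycles_map) (fun z => @coboundaries_map (val z)).
End CohMap.

Section Connecting.
Variables (K L M : cochain_complex) (f : cochain_map K L) (g : cochain_map L M).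
Hypothesis fg_exact : forall n, short_exact (f n) (g n).
Variable n : nat.

Let fI k : injective (f k). Proof. by case: (fg_exact k). Qed.
Let gS k z : exists y, g k y = z. Proof. by case: (fg_exact k). Qed.
Let fgE k y : g k y = 0 <-> exists x, f k x = y.
Proof. by case: (fg_exact k). Qed.

Fact snake_subproof (z : submod (cocycles M n)) :
  exists yx : L n * K n.+1,
    g n yx.1 = val z /\ f n.+1 yx.2 = cdiff L n yx.1.
Proof.
have [y gy] := gS (val z); have: g n.+1 (cdiff L n y) = 0.
  by rewrite cmapD gy; exact: (submodP z).
by case/fgE=> x fx; exists (y, x).
Qed.

Definition snake (z : submod (cocycles M n)) : K n.+1 :=
  (sval (cid (snake_subproof z))).2.

Fact snake_cocycle z : cdiff K n.+1 (snake z) = 0.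
Proof.
rewrite /snake; case: cid => -[y x] /= [_ fx].
by apply: fI; rewrite cmapD fx cdiffK linear0.
Qed.

Definition connecting_fun (c : cohomology M n) : cohomology K n.+1 :=
  coh_class (snake_cocycle (quot_repr c)).

Fact coboundaries_lift (w : M n) :
  coboundaries M n w -> exists2 y, g n y = w & cdiff L n y = 0.
Proof.
case: n w => [|k] w /=; first by move->; exists 0; rewrite linear0.
by move=> [u _ <-]; have [v <-] := gS u; exists (cdiff L k v); rewrite ?cmapD ?cdiffK.
Qed.

Lemma connecting_funE (z : M n) (dz : cdiff M n z = 0) (y : L n)
    (x : K n.+1) (dx : cdiff K n.+1 x = 0) :
  g n y = z -> f n.+1 x = cdiff L n y ->
  connecting_fun (coh_class dz) = coh_class dx.
Proof.
move=> gy fx; apply/quot_piP; rewrite /= /snake.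
set w := quot_repr _; case: cid => -[y' x'] /= [gy' fx'].
have /coboundaries_lift[y0 gy0 dy0] : coboundaries M n (val w - z).
  by have /quot_piP := quot_reprK (coh_class dz).
have /fgE[t ft] : g n (y' - y - y0) = 0.
  by rewrite !linearB /= gy' gy gy0 subrr.
exists t => //; apply: fI.
by rewrite linearB /= fx fx' cmapD ft !linearB /= dy0 subr0.
Qed.

Lemma coh_classP (c : cohomology M n) :
  exists (z : M n) (dz : cdiff M n z = 0), c = coh_class dz.
Proof.
have dz := submodP (quot_repr c); exists (val (quot_repr c)), dz.
by rewrite -[LHS]quot_reprK; congr quot_pi; apply: val_inj.
Qed.

Fact connecting_linear : linear connecting_fun.
Proof.
move=> a c1 c2; have [z1 [dz1 ->]] := coh_classP c1.
have [z2 [dz2 ->]] := coh_classP c2.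
have [[y1 x1] /= [gy1 fx1]] := snake_subproof (in_submod (N := cocycles M n) dz1).
have [[y2 x2] /= [gy2 fx2]] := snake_subproof (in_submod (N := cocycles M n) dz2).
have dx y x : f n.+1 x = cdiff L n y -> cdiff K n.+1 x = 0.
  by move=> fx; apply: fI; rewrite cmapD fx cdiffK linear0.
have dz : cdiff M n (a *: z1 + z2) = 0 by rewrite linearP dz1 dz2 scaler0 addr0.
have -> : a *: coh_class dz1 + coh_class dz2 = coh_class dz.
  by rewrite /coh_class -linearP; congr quot_pi; apply: val_inj.
have fx : f n.+1 (a *: x1 + x2) = cdiff L n (a *: y1 + y2).
  by rewrite !linearP fx1 fx2.
have gy : g n (a *: y1 + y2) = a *: z1 + z2 by rewrite linearP gy1 gy2.
rewrite (connecting_funE dz1 (dx _ _ fx1) gy1 fx1).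
rewrite (connecting_funE dz2 (dx _ _ fx2) gy2 fx2).
rewrite (connecting_funE dz (dx _ _ fx) gy fx).
by rewrite /coh_class -linearP; congr quot_pi; apply: val_inj.
Qed.

Definition connecting : {linear cohomology M n -> cohomology K n.+1} :=
  mk_linear connecting_linear.

End Connecting.
End Complexes.

Section LocalCohomology.
Variables (A : comNzRingType).

Lemma ideal_gen_is_ideal (X : set A) : is_ideal (ideal_gen X).
Proof.
split=> [J [[J0 _] _] //|a x y Xx Xy J JX].
by case: (JX) => -[_ JP] _; apply: JP; [apply: Xx | apply: Xy].
Qed.

Lemma ideal_exp_le (I : set A) k l :
  (k <= l)%N -> ideal_exp I l `<=` ideal_exp I k.
Proof.
move=> /subnK <-; elim: (l - k)%N => [//|d IHd] x Ix; apply: IHd.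
apply: Ix; split=> [|y [a aI <-]]; first exact: ideal_gen_is_ideal.
rewrite big_ord_recr /= mulrC -[_ * _]addr0.
have [I0 IP] := ideal_gen_is_ideal [set \prod_(j < d + k) a j |
  a in [set a : 'I_(d + k) -> A | forall j, I (a j)]].
apply: IP I0 => J [_ XJ]; apply: XJ.
by exists (fun j => a (widen_ord (leqnSn (d + k)) j)) => //= j; apply: aI.
Qed.

Section Torsion.
Variables (I : set A) (M : lmodType A).

Let torsion_set : set M :=
  [set x | exists n, forall a, ideal_exp I n a -> a *: x = 0].

Fact torsion0 : torsion_set 0.
Proof. by exists 0%N => a _; rewrite scaler0. Qed.

Fact torsion_subproof a x y :
  torsion_set x -> torsion_set y -> torsion_set (a *: x + y).
Proof.
move=> [k kx] [l ly]; exists (maxn k l) => b Ib.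
rewrite scalerDr scalerA mulrC -scalerA.
rewrite kx ?ly ?scaler0 ?addr0 //.
  exact: ideal_exp_le (leq_maxr k l) _ Ib.
exact: ideal_exp_le (leq_maxl k l) _ Ib.
Qed.

Definition torsion : submodule M := Submodule torsion0 torsion_subproof.

End Torsion.

Fact torsion_map I (M N : lmodType A) (f : {linear M -> N}) x :
  torsion I M x -> torsion I N (f x).
Proof.
by move=> [k kx]; exists k => a Ia; rewrite -linearZ_LR kx // linear0.
Qed.

Definition Gamma I (M : lmodType A) : lmodType A := submod (torsion I M).

Definition Gamma_map I (M N : lmodType A) (f : {linear M -> N}) :
  {linear Gamma I M -> Gamma I N} := sub_map (@torsion_map I M N f).

Fact Gamma_cxK I (K : cochain_complex A) n (x : Gamma I (K n)) :
  Gamma_map I (cdiff K n.+1) (Gamma_map I (cdiff K n) x) = 0.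
Proof. by apply: val_inj; apply: cdiffK. Qed.

Definition Gamma_cx I (K : cochain_complex A) : cochain_complex A :=
  CochainComplex (@Gamma_cxK I K).

Fact Gamma_cmapD I (K L : cochain_complex A) (f : cochain_map K L) n
    (x : Gamma_cx I K n) :
  Gamma_map I (f n.+1) (cdiff (Gamma_cx I K) n x)
  = cdiff (Gamma_cx I L) n (Gamma_map I (f n) x).
Proof. by apply: val_inj; apply: cmapD. Qed.

Definition Gamma_cmap I (K L : cochain_complex A) (f : cochain_map K L) :
  cochain_map (Gamma_cx I K) (Gamma_cx I L) :=
  @CochainMap A (Gamma_cx I K) (Gamma_cx I L) (fun n => Gamma_map I (f n))
    (@Gamma_cmapD I K L f).

Lemma Gamma_short_exact I (U V W : lmodType A)
    (f : {linear U -> V}) (g : {linear V -> W}) :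
  injective_module U -> short_exact f g ->
  short_exact (Gamma_map I f) (Gamma_map I g).
Proof.
move=> injU [fI gS fgE].
have [r /= rf] := injU _ _ f (idfun : {linear U -> U}) fI.
split=> [x y /(congr1 val)/= /fI/val_inj //|z|y].
  have [k kz] := submodP z; have [y0 gy0] := gS (val z).
  have gf u : g (f u) = 0 by apply/fgE; exists u.
  pose y := y0 - f (r y0).
  have ty : torsion I V y.
    exists k => a Ia; have /fgE[x fx] : g (a *: y) = 0.
      by rewrite linearZ_LR linearB /= gf subr0 gy0 kz.
    have : r (a *: y) = 0 by rewrite linearZ_LR linearB /= rf subrr scaler0.
    by rewrite -fx rf => ->; rewrite linear0.
  exists (in_submod ty); apply: val_inj.
  by rewrite /= linearB /= gf subr0.
split=> [/(congr1 val)/= /fgE[x fx]|[x <-]]; last first.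
  by apply: val_inj; apply/fgE; exists (val x).
have [k ky] := submodP y.
have tx : torsion I U x.
  by exists k => a Ia; apply: fI; rewrite linearZ_LR fx ky // linear0.
by exists (in_submod tx); apply: val_inj.
Qed.

Record injective_resolution (M : lmodType A) : Type := InjectiveResolution {
  res_cx :> cochain_complex A;
  res_aug : {linear M -> res_cx 0};
  res_aug_inj : injective res_aug;
  res_exact0 : forall x, cdiff res_cx 0 x = 0 -> exists y, res_aug y = x;
  res_augK : forall y, cdiff res_cx 0 (res_aug y) = 0;
  res_exact : forall n x, cdiff res_cx n.+1 x = 0 ->
    exists y, cdiff res_cx n y = x;
  res_injective : forall n, injective_module (res_cx n) }.

(* H^n_I(M) as the n-th right derived functor of Gamma_I. It depends on the
   choice of the injective resolution E of M only up to canonical isomorphism. *)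
Definition local_cohomology (I : set A) (M : lmodType A)
  (E : injective_resolution M) (n : nat) : lmodType A :=
  cohomology (Gamma_cx I E) n.

(* H^(n-1)_I(M), which is zero for n = 0. *)
Definition local_cohomology_pred (I : set A) (M : lmodType A)
  (E : injective_resolution M) (n : nat) : lmodType A :=
  match n with
  | 0 => 'rV[A]_0
  | n'.+1 => local_cohomology I E n'
  end.

Definition lifts (M N : lmodType A) (h : {linear M -> N})
  (E : injective_resolution M) (F : injective_resolution N)
  (phi : cochain_map E F) : Prop :=
  forall x, phi 0%N (res_aug E x) = res_aug F (h x).

Definition local_cohomology_map I (M N : lmodType A)
  (E : injective_resolution M) (F : injective_resolution N)
  (phi : cochain_map E F) n :
  {linear local_cohomology I E n -> local_cohomology I F n} :=
  coh_map (Gamma_cmap I phi) n.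

(* A short exact sequence of injective resolutions of the terms of
   0 -> M' -> M -> M'' -> 0, as given by the horseshoe lemma. *)
Record resolution_ses (M' M M'' : lmodType A)
    (f : {linear M' -> M}) (g : {linear M -> M''}) : Type := ResolutionSes {
  ses_left : injective_resolution M';
  ses_mid : injective_resolution M;
  ses_right : injective_resolution M'';
  ses_f : cochain_map ses_left ses_mid;
  ses_g : cochain_map ses_mid ses_right;
  ses_f_lifts : lifts f ses_f;
  ses_g_lifts : lifts g ses_g;
  ses_exact : forall n, short_exact (ses_f n) (ses_g n) }.

Section Delta.
Variables (M' M M'' : lmodType A).
Variables (f : {linear M' -> M}) (g : {linear M -> M''}).
Variables (I : set A) (X : resolution_ses f g).

Fact Gamma_ses_exact n :
  short_exact (Gamma_cmap I (ses_f X) n) (Gamma_cmap I (ses_g X) n).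
Proof.
by apply: Gamma_short_exact; [apply: res_injective | apply: ses_exact].
Qed.

Definition local_cohomology_delta n :
  {linear local_cohomology I (ses_right X) n ->
          local_cohomology I (ses_left X) n.+1} :=
  connecting Gamma_ses_exact n.

End Delta.

Section Bockstein.
Variable u : A.

Definition mul_by : {linear A^o -> A^o} := u \*: (idfun : {linear A^o -> A^o}).

Definition mod_by : lmodType A := quotmod (im mul_by).

Definition mod_pi : {linear A^o -> mod_by} := quot_pi (im mul_by).

(* The data from which the Bockstein homomorphism is computed: a short exact
   sequence of injective resolutions over 0 -> A -> A -> A/uA -> 0, which
   gives delta, and a lift of A -> A/uA between the resolutions of A and A/uA
   used in the target and the source of delta, which gives pi. Different data
   yield the same homomorphism up to the canonical isomorphisms. *)
Record bockstein_data : Type := BocksteinData {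
  bock_ses :> resolution_ses mul_by mod_pi;
  bock_lift : cochain_map (ses_left bock_ses) (ses_right bock_ses);
  bock_liftP : lifts mod_pi bock_lift }.

(* beta^(n-1)_{u,J} : H^(n-1)_J(A/uA) -> H^n_J(A/uA) *)
Definition bockstein (J : set A) (X : bockstein_data) (n : nat) :
  local_cohomology_pred J (ses_right X) n -> local_cohomology J (ses_right X) n :=
  match n with
  | 0 => fun=> 0
  | n'.+1 => fun c => local_cohomology_map J (bock_lift X) n'.+1
                        (local_cohomology_delta J X n' c)
  end.

End Bockstein.
End LocalCohomology.

Arguments ideal_extension {A} f I _.
Arguments bockstein {A u} J X n _.

(* Main.v *)
Require Import Defs.
From HB Require Import structures.
From mathcomp Require Import all_boot all_order all_algebra.
From mathcomp Require Import boolp classical_sets.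

Set Implicit Arguments.
Unset Strict Implicit.
Unset Printing Implicit Defensive.

Import GRing.Theory.
Local Open Scope classical_set_scope.
Local Open Scope ring_scope.

(** S is free of finite rank over R, so H_{IS}(S) is a direct sum of copies of
    H_I(R) and multiplication by p is injective on H^i_{IS}(S). As p kills the
    image of the connecting map, delta_{p,IS} vanishes in degree i, and so does
    beta_{p,IS}. To pass from IS to J, compare both with K = J + pS, which has
    the same radical as IS + pS. A torsion element of an injective module over
    a Noetherian ring is divisible by p inside the torsion submodule, and p is
    null-homotopic on a resolution E of S/pS; hence Gamma_K E -> Gamma_J E is a
    quasi-isomorphism, compatible with the construction of the Bockstein map. *)

(** * Ideals, Noetherian rings and torsion *)

Section IdealTheory.
Variable A : comNzRingType.
Implicit Types I J Q X : set A.

Lemma ideal_gen_sub X Q : is_ideal Q -> X `<=` Q -> ideal_gen X `<=` Q.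
Proof. by move=> idQ XQ x; apply. Qed.

Lemma sub_ideal_gen X : X `<=` ideal_gen X.
Proof. by move=> x Xx Q [_]; apply. Qed.

Lemma idealD Q x y : is_ideal Q -> Q x -> Q y -> Q (x + y).
Proof. by move=> [_ QP] Qx Qy; rewrite -[x]mul1r; apply: QP. Qed.

Lemma idealMl Q a x : is_ideal Q -> Q x -> Q (a * x).
Proof. by move=> [Q0 QP] Qx; rewrite -[_ * _]addr0; apply: QP. Qed.

Lemma idealMr Q a x : is_ideal Q -> Q x -> Q (x * a).
Proof. by rewrite mulrC; apply: idealMl. Qed.

Lemma idealN Q x : is_ideal Q -> Q x -> Q (- x).
Proof. by rewrite -mulN1r; apply: idealMl. Qed.

Lemma ideal_sum Q n (F : 'I_n -> A) :
  is_ideal Q -> (forall i, Q (F i)) -> Q (\sum_(i < n) F i).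
Proof.
move=> idQ QF; apply: (big_ind Q) => //; first by case: idQ.
by move=> x y; apply: idealD.
Qed.

Lemma radical_ideal Q : is_ideal Q -> is_ideal (radical Q).
Proof.
move=> idQ; split=> [|a x y [k Qx] [l Qy]].
  by exists 1%N; rewrite expr1; case: idQ.
exists (k + l)%N; rewrite exprDn; apply: ideal_sum => // i.
rewrite -mulr_natr; apply: idealMr => //.
have [li|/ltnW il] := leqP l i.
  by rewrite -(subnK li) exprD mulrA; apply: idealMl.
rewrite -addnBA // exprD exprMn; do 2!apply: idealMr => //.
exact: idealMl.
Qed.

Definition colon Q a : set A := [set x | Q (x * a)].

Lemma colon_ideal Q a : is_ideal Q -> is_ideal (colon Q a).
Proof.
move=> [Q0 QP]; split=> [|b x y]; first by rewrite /colon/= mul0r.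
by rewrite /colon /= mulrDl -mulrA; apply: QP.
Qed.

(** A product is linear in each factor: with the others fixed, the factors carrying it into [Q] form
    a colon ideal. So the last factor, then by induction the others, may be taken in [X]. *)
Lemma ideal_exp_gen_sub X Q k :
  is_ideal Q -> (forall a : 'I_k -> A, (forall j, X (a j)) -> Q (\prod_j a j)) ->
  ideal_exp (ideal_gen X) k `<=` Q.
Proof.
move=> idQ QX; apply: ideal_gen_sub => // _ [a /= Xa <-].
elim: k Q idQ QX a Xa => [|k IHk] Q idQ QX a Xa.
  by rewrite big_ord0; have := QX a; rewrite big_ord0; apply=> -[].
rewrite big_ord_recr /= mulrC; set b := \prod_(j < k) _.
suff: ideal_gen X `<=` colon Q b by apply; apply: Xa.
apply: ideal_gen_sub => [|c Xc]; first exact: colon_ideal.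
rewrite /colon /= mulrC.
apply: (IHk (colon Q c)) => // [|e Xe]; first exact: colon_ideal.
have := QX (fun j => if unlift ord_max j is Some j' then e j' else c).
rewrite big_ord_recr /= unlift_none; under eq_bigr => j _.
  have -> : widen_ord (leqnSn k) j = lift ord_max j.
    by apply: val_inj; rewrite /= /bump leqNgt ltn_ord.
  by rewrite liftK; over.
by apply=> j; case: unliftP.
Qed.

Lemma ideal_exp_expr J a k : J a -> ideal_exp J k (a ^+ k).
Proof.
move=> Ja; apply: sub_ideal_gen; exists (fun=> a) => //.
by rewrite prodr_const card_ord.
Qed.

(** Pigeonhole: if the [a i] generate [J] and [a i ^+ s i] lies in [Q], a product of more than
    [\sum_i s i] generators contains some [a i] at least [s i] times. *)
Lemma ideal_exp_sub_radical J Q : noetherian A -> is_ideal J -> is_ideal Q ->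
  J `<=` radical Q -> exists k, ideal_exp J k `<=` Q.
Proof.
move=> noethA idJ idQ JQ; have [n [a Ea]] := noethA J idJ.
have Ja i : J (a i) by rewrite Ea; apply: sub_ideal_gen; exists i.
pose s i := sval (cid (JQ _ (Ja i))).
have Qs i : Q (a i ^+ s i) by rewrite /s; case: cid.
exists (\sum_i s i).+1; rewrite {1}Ea; apply: ideal_exp_gen_sub => // b ab.
pose h j := sval (cid2 (ab j)).
have hE j : b j = a (h j) by rewrite /h; case: cid2.
rewrite (partition_big h xpredT) //=.
have [i si] : exists i, (s i <= #|[pred j | h j == i]|)%N.
  (* Otherwise the number of factors is at most [\sum_i s i]. The one extra factor gives the
     contradiction, also for an empty family of generators. *)
  apply: contrapT => /forallNP ns.
  have: (\sum_i #|[pred j | h j == i]| <= \sum_i s i)%N.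
    by apply: leq_sum => i _; have /negP := ns i; rewrite -ltnNge => /ltnW.
  have -> : (\sum_i #|[pred j | h j == i]| = (\sum_i s i).+1)%N.
    rewrite -[RHS]card_ord -sum1_card (partition_big h xpredT) //=.
    by apply: eq_bigr => i _; rewrite -sum1_card; apply: eq_bigl.
  by rewrite ltnn.
rewrite (bigD1 i) //=; apply: idealMr => //.
rewrite (eq_bigr (fun=> a i)) => [|j /eqP <-]; last exact: hE.
by rewrite prodr_const -(subnK si) exprD; apply: idealMl.
Qed.

Lemma noetherian_chain (C : nat -> set A) :
  noetherian A -> (forall k, is_ideal (C k)) ->
  (forall k l, (k <= l)%N -> C k `<=` C l) ->
  exists k, forall l, C l `<=` C k.
Proof.
move=> noethA idC mC; pose U := \bigcup_k C k.
have idU : is_ideal U.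
  split=> [|a x y [k _ Cx] [l _ Cy]]; first by exists 0%N => //; case: (idC 0%N).
  exists (maxn k l) => //; case: (idC (maxn k l)) => _; apply.
    exact: mC (leq_maxl k l) _ Cx.
  exact: mC (leq_maxr k l) _ Cy.
have [n [a Ea]] := noethA U idU.
have Ua i : U (a i) by rewrite Ea; apply: sub_ideal_gen; exists i.
pose s i := sval (cid2 (Ua i)).
have Cs i : C (s i) (a i) by rewrite /s; case: cid2.
exists (\max_i s i) => l x Cx.
have: U x by exists l.
rewrite Ea; apply: ideal_gen_sub => // _ [i _ <-].
exact: mC (leq_bigmax i) _ (Cs i).
Qed.

(** Otherwise choosing strictly larger members, starting from [Q0], gives a chain that never
    stabilizes. *)
Lemma noetherian_maximal (F : set (set A)) Q0 :
  noetherian A -> F `<=` @is_ideal A -> F Q0 ->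
  exists2 Q, F Q & forall Q', F Q' -> Q `<=` Q' -> Q' `<=` Q.
Proof.
move=> noethA idF FQ0; apply: contrapT => nmax.
have step (Q : {Q | F Q}) : {Q' : {Q | F Q} | sval Q `<` sval Q'}.
  case: Q => Q FQ; apply: cid; apply: contrapT => nQ; apply: nmax; exists Q => //.
  move=> Q' FQ' QQ'; apply: contrapT => nQ'; apply: nQ.
  by exists (exist _ Q' FQ').
pose C k : {Q | F Q} := iter k (fun Q : {Q | F Q} => sval (step Q)) (exist F Q0 FQ0).
have CS k : sval (C k) `<` sval (C k.+1) by rewrite /C iterS; case: (step _).
have [k Ck] : exists k, forall l, sval (C l) `<=` sval (C k).
  apply: (@noetherian_chain (fun k => sval (C k))) => // [k|k l].
    exact: idF (svalP (C k)).
  move=> /subnK <-; elim: (l - k)%N => [//|d IHd] x /IHd Cx.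
  by case: (CS (d + k)%N) => + _; apply.
by case: (CS k) => _; apply; apply: Ck.
Qed.

Section Annihilator.
Variables (M : lmodType A) (x : M).

Definition ann : set A := [set a | a *: x = 0].

Lemma ann_ideal : is_ideal ann.
Proof.
split=> [|a b c /= bx cx]; first exact: scale0r.
by rewrite /ann /= scalerDl -scalerA bx cx scaler0 addr0.
Qed.

Lemma torsion_sub_radical J : torsion J M x -> J `<=` radical ann.
Proof. by move=> [k kx] a Ja; exists k; apply: kx; apply: ideal_exp_expr. Qed.

(** Finite generation of [J] makes the exponents of its elements uniform, so torsion is read off the
    radical of the annihilator; changes of support reduce to this. *)
Lemma torsionP J : noetherian A -> is_ideal J ->
  torsion J M x <-> J `<=` radical ann.
Proof.
move=> noethA idJ; split=> [|Jx]; first exact: torsion_sub_radical.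
by have [k] := ideal_exp_sub_radical noethA idJ ann_ideal Jx; exists k.
Qed.

End Annihilator.

Lemma torsion_add_principal J u (M : lmodType A) (x : M) :
  noetherian A -> is_ideal J ->
  torsion (ideal_add J (ideal_gen [set u])) M x <->
  torsion J M x /\ exists k, u ^+ k *: x = 0.
Proof.
move=> noethA idJ; have idK := ideal_gen_is_ideal (J `|` ideal_gen [set u]).
rewrite !torsionP //; split=> [Kx|[Jx ux]].
  by split=> [a Ja|]; apply: Kx; apply: sub_ideal_gen;
    [left | right; apply: sub_ideal_gen].
have idr := radical_ideal (ann_ideal x).
apply: ideal_gen_sub => // a [/Jx//|]; apply: ideal_gen_sub => // _ -> //.
Qed.

Lemma torsion_radical_eq J K (M : lmodType A) (x : M) :
  noetherian A -> is_ideal J -> is_ideal K -> radical J = radical K ->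
  torsion J M x -> torsion K M x.
Proof.
move=> noethA idJ idK JK; rewrite !torsionP // => Jx a Ka.
have: radical J a by rewrite JK; exists 1%N; rewrite expr1.
by case=> k /Jx[l]; rewrite -exprM; exists (k * l)%N.
Qed.

End IdealTheory.

(** * Injective modules and their resolutions *)

Section InjectiveModules.
Variable A : comNzRingType.

(** [g] descends to the image of [f], whose inclusion in [V] is injective. *)
Lemma injective_extension (E U V : lmodType A) (f : {linear U -> V})
    (g : {linear U -> E}) :
  injective_module E -> (forall x, f x = 0 -> g x = 0) ->
  exists h : {linear V -> E}, forall x, h (f x) = g x.
Proof.
move=> injE fg; have fw (w : submod (im f)) : exists x, f x = val w.
  by have [x _ <-] := submodP w; exists x.
pose s w := sval (cid (fw w)).
have sE w : f (s w) = val w by rewrite /s; case: cid.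
have eqg x y : f x = f y -> g x = g y.
  move=> fxy; apply/eqP; rewrite -subr_eq0 -linearB; apply/eqP/fg.
  by rewrite linearB /= fxy subrr.
have lin_gs : linear (fun w => g (s w)).
  by move=> a v w; rewrite -linearP; apply: eqg; rewrite linearP !sE.
have [h hE] := injE _ _ (submod_incl (im f)) (mk_linear lin_gs) val_inj.
exists h => x; have fx : im f (f x) by exists x.
rewrite (hE (in_submod fx)); apply: eqg; exact: sE.
Qed.

(* The Krull-type argument behind the Artin-Rees lemma: an ideal [Q] maximal
   for [u * b \in Q <-> b *: y = 0] contains a power of each [a \in J]. *)
Lemma torsion_divisible (E : lmodType A) (J : set A) (u : A) (y : E) :
  noetherian A -> injective_module E -> is_ideal J -> GRing.lreg u ->
  torsion J E y -> exists2 y', torsion J E y' & u *: y' = y.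
Proof.
move=> noethA injE idJ ureg Jy.
pose F := [set Q : set A | is_ideal Q /\ forall b, Q (u * b) <-> b *: y = 0].
(* The family contains [u] times the annihilator of [y], by regularity of [u]. *)
have [||Q [idQ QE] maxQ] := @noetherian_maximal A F
    [set x | exists2 b, b *: y = 0 & x = u * b] noethA; first by move=> Q [].
  split=> [|b].
    split=> [|a _ _ [b by0 ->] [c cy0 ->]].
      by exists 0; rewrite ?scale0r ?mulr0.
    exists (a * b + c); last by rewrite mulrDr mulrCA.
    by rewrite scalerDl -scalerA by0 cy0 scaler0 addr0.
  by split=> [[c cy0 /ureg->]//|by0]; exists b.
(* The colon ideals of [Q] by powers of [a] stabilize at some exponent [s]. Then [Q' = Q + (a ^+ s)]
   stays in [F], and maximality puts [a ^+ s] in [Q]. *)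
have JQ : J `<=` radical Q.
  move=> a Ja; have [k ky] := torsion_sub_radical Jy Ja.
  have [||s Cs] := @noetherian_chain A (fun t => colon Q (a ^+ t)) noethA.
  - by move=> t; apply: colon_ideal.
  - move=> t l tl x Qx; rewrite /colon /= -(subnK tl) exprD mulrCA.
    exact: idealMl.
  exists s; pose Q' := [set x | exists c, Q (x - c * a ^+ s)].
  suff: F Q'.
    move=> FQ'; apply: (maxQ Q') => // [x Qx|].
      by exists 0; rewrite mul0r subr0.
    by exists 1; rewrite mul1r subrr; case: idQ.
  split=> [|b]; last first.
    split=> [[c Qc]|/QE Qb]; last by exists 0; rewrite mul0r subr0.
    (* As [a ^+ k] kills [y], multiplying by it shows that [c * a ^+ (s + k)] lies in [Q]; by
       stability so does [c * a ^+ s], hence [u * b]. *)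
    apply/QE; have : Q (a ^+ k * (u * b)).
      by rewrite mulrCA; apply/QE; rewrite mulrC -scalerA ky scaler0.
    move=> Qaub; have : Q (c * a ^+ (s + k)).
      have := idealD idQ Qaub (idealN idQ (idealMl (a ^+ k) idQ Qc)).
      by rewrite mulrBr opprB addrC subrK mulrCA -exprD addnC.
    move=> /(Cs (s + k)%N) Qcs; have := idealD idQ Qc Qcs.
    by rewrite subrK.
  split=> [|b x x' [c Qc] [c' Qc']].
    by exists 0; rewrite mul0r subr0; case: idQ.
  exists (b * c + c').
  have := idealD idQ (idealMl b idQ Qc) Qc'.
  by rewrite mulrDl mulrBr opprD addrACA mulrA.
have subQ : forall a (x x' : A^o), Q x -> Q x' -> Q (a *: x + x').
  by move=> a x x'; case: idQ => _; apply.
pose Qs := @Submodule A A^o Q (idQ.1) subQ.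
(* The map [(q, b) |-> b *: y] vanishes where [q + u * b = 0], since then [u * b] lies in [Q]. Its
   extension [h] along [q + u * b] has [h 1] killed by [Q], hence torsion, and [u *: h 1 = y]. *)
have lin_f : linear (fun z : submod Qs * A^o => val z.1 + u * z.2 : A^o).
  move=> a [q b] [q' b'] /=.
  by rewrite mulrDr -[a *: b]/(a * b) mulrCA addrACA scalerDr.
have lin_g : linear (fun z : submod Qs * A^o => (z.2 : A) *: y).
  by move=> a [q b] [q' b'] /=; rewrite scalerDl scalerA.
have [[q b] /= qb|h hE] := @injective_extension E _ _ (mk_linear lin_f)
    (mk_linear lin_g) injE.
  apply/QE; rewrite -[u * b](addKr (val q)) qb addr0.
  by apply: idealN => //; apply: (submodP q).
exists (h 1).
  apply/torsionP => // a /JQ[k Qk]; exists k; rewrite /ann /= -linearZ_LR /=.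
  have Qk' : Qs (a ^+ k : A^o) by [].
  have := hE (in_submod Qk', 0).
  rewrite /= mulr0 addr0 scale0r => <-; congr (h _).
  by rewrite /GRing.scale /= mulr1.
have := hE (0, 1).
rewrite /= mulr1 add0r scale1r => <-; rewrite -linearZ_LR /=; congr (h _).
by rewrite /GRing.scale /= mulr1.
Qed.

End InjectiveModules.

(** * Comparison of injective resolutions, and coboundaries of torsion subcomplexes *)

Section Comparison.
Variable A : comNzRingType.

(** Builds chain maps and homotopies degree by degree: [R] links consecutive terms, and the
    invariant [P] keeps each choice extendable. *)
Lemma dependent_recursion (T : nat -> Type) (P : forall n, T n -> Prop)
    (R : forall n, T n -> T n.+1 -> Prop) :
  (exists x, P 0%N x) ->
  (forall n x, P n x -> exists2 y, P n.+1 y & R n x y) ->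
  exists s : forall n, T n, P 0%N (s 0%N) /\ forall n, R n (s n) (s n.+1).
Proof.
move=> ex0 step; pose S n (x : {x | P n x}) := cid2 (step n _ (svalP x)).
pose t := fix t n : {x | P n x} := match n with
  | 0 => cid ex0
  | k.+1 => exist (P k.+1) (s2val (S k (t k))) (s2valP (S k (t k)))
  end.
exists (fun n => sval (t n)); split; first exact: (svalP (t 0%N)).
by move=> n; apply: (s2valP' (S n (t n))).
Qed.

Lemma lift_exists (M N : lmodType A) (h : {linear M -> N})
    (E : injective_resolution M) (F : injective_resolution N) :
  exists phi : cochain_map E F, lifts h phi.
Proof.
(* The invariant says that [cdiff F n \o f] vanishes on the kernel of [cdiff E n], so that it
   extends along [cdiff E n] by injectivity of [F n.+1]. *)
pose P n (f : {linear E n -> F n}) :=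
  (forall x, cdiff E n x = 0 -> cdiff F n (f x) = 0) /\
  match n return {linear E n -> F n} -> Prop with
  | 0 => fun f => forall x, f (res_aug E x) = res_aug F (h x)
  | _ => fun=> True end f.
pose R n (f : {linear E n -> F n}) (g : {linear E n.+1 -> F n.+1}) :=
  forall x, g (cdiff E n x) = cdiff F n (f x).
have [||s [[_ s0] sS]] := @dependent_recursion _ P R.
- have [x /= augx|f fE] := @injective_extension A (F 0%N) M (E 0%N) (res_aug E)
    (res_aug F \o h : {linear M -> F 0%N}) (@res_injective _ _ F 0).
    suff -> : x = 0 by rewrite !linear0.
    by apply: (@res_aug_inj _ _ E); rewrite augx linear0.
  exists f; split=> // x /res_exact0[y <-].
  by rewrite fE /= res_augK.
- move=> n f [fP _].
  have [x /= /fP//|g gE] := @injective_extension A (F n.+1) (E n) (E n.+1)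
    (cdiff E n) (cdiff F n \o f : {linear E n -> F n.+1})
    (@res_injective _ _ F n.+1).
  exists g => //; split=> // x /res_exact[y <-].
  by rewrite gE /= cdiffK.
- by exists (CochainMap sS).
Qed.

Lemma null_homotopy (M N : lmodType A)
    (E : injective_resolution M) (F : injective_resolution N)
    (phi : cochain_map E F) :
  (forall x, phi 0%N (res_aug E x) = 0) ->
  exists s : forall n, {linear E n.+1 -> F n},
    (forall x, phi 0%N x = s 0%N (cdiff E 0 x)) /\
    (forall n x, phi n.+1 x = cdiff F n (s n x) + s n.+1 (cdiff E n.+1 x)).
Proof.
move=> phi0.
(* The invariant says that [phi n.+1 - cdiff F n \o s] vanishes on coboundaries, hence by exactness
   on the kernel of [cdiff E n.+1]; extending it along that differential gives the next homotopy. *)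
pose P n (s : {linear E n.+1 -> F n}) :=
  (forall x, cdiff F n (s (cdiff E n x)) = cdiff F n (phi n x)) /\
  match n return {linear E n.+1 -> F n} -> Prop with
  | 0 => fun s => forall x, phi 0%N x = s (cdiff E 0 x)
  | _ => fun=> True end s.
pose R n (s : {linear E n.+1 -> F n}) (t : {linear E n.+2 -> F n.+1}) :=
  forall x, phi n.+1 x = cdiff F n (s x) + t (cdiff E n.+1 x).
have [||s [[_ s0] sS]] := @dependent_recursion _ P R; last by exists s.
- have [x /res_exact0[y <-]//|s sE] := @injective_extension A (F 0%N) (E 0%N)
    (E 1%N) (cdiff E 0) (phi 0%N) (@res_injective _ _ F 0).
  by exists s; split=> x; rewrite sE.
- move=> n s [sP _].
  have [x /= /res_exact[y <-]|t tE] := @injective_extension A (F n.+1) (E n.+1)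
    (E n.+2) (cdiff E n.+1)
    (phi n.+1 \- (cdiff F n \o s) : {linear E n.+1 -> F n.+1})
    (@res_injective _ _ F n.+1).
    by rewrite /= cmapD sP subrr.
  exists t; last by move=> x; rewrite tE /= addrC subrK.
  by split=> // x; rewrite tE linearB /= cdiffK subr0.
Qed.

(** The coboundaries of [Gamma_cx J K], seen as elements of [K] so that one element can be tested
    against several supports. *)
Definition torsion_coboundary (J : set A) (K : cochain_complex A) n : set (K n) :=
  match n with
  | 0 => [set x | x = 0]
  | k.+1 => [set x | exists2 w, torsion J (K k) w & cdiff K k w = x]
  end.

Lemma coh_map_class (K L : cochain_complex A) (phi : cochain_map K L) n x
    (dx : cdiff K n x = 0) (dphix : cdiff L n (phi n x) = 0) :
  coh_map phi n (coh_class dx) = coh_class dphix.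
Proof.
rewrite [LHS]quot_map_funE => [|z]; last exact: coboundaries_map.
by congr quot_pi; apply: val_inj.
Qed.

Lemma coh_class_eq0 (J : set A) (K : cochain_complex A) n
    (x : Gamma_cx J K n) (dx : cdiff (Gamma_cx J K) n x = 0) :
  coh_class dx = 0 <-> torsion_coboundary J (val x).
Proof.
rewrite -[0](linear0 (quot_pi _)) /coh_class; split.
  move/quot_piP; rewrite subr0 /=; case: n x dx => [|n] x dx /=.
    by move->.
  by move=> [w _ <-]; exists (val w) => //; apply: (submodP w).
move=> cx; apply/quot_piP; rewrite subr0 /=.
case: n x dx cx => [|n] x dx /=; first by move=> x0; apply: val_inj.
move=> [w Jw wx]; exists (in_submod (N := torsion J (K n)) Jw) => //.
exact: val_inj.
Qed.

Lemma coh_class_eq (J : set A) (K : cochain_complex A) n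
    (x y : Gamma_cx J K n) (dx : cdiff (Gamma_cx J K) n x = 0)
    (dy : cdiff (Gamma_cx J K) n y = 0) :
  torsion_coboundary J (val x - val y) -> coh_class dx = coh_class dy.
Proof.
move=> cxy; have dxy : cdiff (Gamma_cx J K) n (x - y) = 0.
  by rewrite linearB dx dy subrr.
apply/eqP; rewrite -subr_eq0 -((coh_class_eq0 dxy).2 cxy) /coh_class -linearB.
by apply/eqP; congr quot_pi; apply: val_inj.
Qed.

Lemma torsion_coboundary_map (J : set A) (K L : cochain_complex A)
    (phi : cochain_map K L) n x :
  torsion_coboundary J x -> torsion_coboundary J (phi n x).
Proof.
case: n x => [|n] x /=; first by move->; rewrite linear0.
by move=> [w Jw <-]; exists (phi n w); rewrite ?cmapD //; apply: torsion_map.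
Qed.

Lemma torsion_coboundaryD (J : set A) (K : cochain_complex A) n a (x y : K n) :
  torsion_coboundary J x -> torsion_coboundary J y ->
  torsion_coboundary J (a *: x + y).
Proof.
case: n x y => [|n] x y /=; first by move=> -> ->; rewrite scaler0 addr0.
move=> [v Jv <-] [w Jw <-]; exists (a *: v + w); last by rewrite linearP.
exact: torsion_subproof.
Qed.

Lemma torsion_coboundary_sub (J J' : set A) (K : cochain_complex A) n (x : K n) :
  (forall k (y : K k), torsion J (K k) y -> torsion J' (K k) y) ->
  torsion_coboundary J x -> torsion_coboundary J' x.
Proof.
by move=> JJ'; case: n x => [//|n] x /= [w /JJ' Jw <-]; exists w.
Qed.

(** A null-homotopy is linear, so it preserves torsion, and on a cocycle it exhibits the value of
    [phi] as a coboundary. *)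
Lemma null_coboundary (M N : lmodType A)
    (E : injective_resolution M) (F : injective_resolution N)
    (phi : cochain_map E F) (J : set A) n (x : E n) :
  (forall y, phi 0%N (res_aug E y) = 0) ->
  torsion J (E n) x -> cdiff E n x = 0 -> torsion_coboundary J (phi n x).
Proof.
move=> /null_homotopy[s [s0 sS]] Jx dx.
case: n x Jx dx => [|n] x Jx dx /=; first by rewrite s0 dx linear0.
exists (s n x); first exact: torsion_map.
by rewrite sS dx linear0 addr0.
Qed.

End Comparison.

(** * Adding a regular element to the support *)

Section Multiplication.
Variables (A : comNzRingType) (u : A).

Fact mul_cmap_subproof (K : cochain_complex A) n (x : K n) :
  (u \*: (idfun : {linear K n.+1 -> K n.+1})) (cdiff K n x) =
  cdiff K n ((u \*: (idfun : {linear K n -> K n})) x).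
Proof. by rewrite /= linearZ_LR. Qed.

Definition mul_cmap (K : cochain_complex A) : cochain_map K K :=
  CochainMap (@mul_cmap_subproof K).

Variables (N : lmodType A) (E : injective_resolution N) (J : set A).
Hypotheses (noethA : noetherian A) (idJ : is_ideal J) (ureg : GRing.lreg u).
Hypothesis uN : forall x : N, u *: x = 0.

Local Notation K := (ideal_add J (ideal_gen [set u])).

(** Multiplication by [u] on [E] lifts the zero map of [N]. *)
Lemma mul_torsion_coboundary n (x : E n) :
  torsion J (E n) x -> cdiff E n x = 0 -> torsion_coboundary J (u *: x).
Proof.
move=> Jx dx; apply: (null_coboundary (phi := mul_cmap E)) => // y.
by rewrite /= -linearZ_LR uN linear0.
Qed.

(** Surjectivity of [H(Gamma_K E) -> H(Gamma_J E)]: write [u *: x = d w], divide [w = u *: v], and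
    take [y = x - d v], which [u] kills. *)
Lemma torsion_add_cocycle n (x : E n) :
  torsion J (E n) x -> cdiff E n x = 0 ->
  exists y : E n, [/\ torsion K (E n) y, cdiff E n y = 0 &
                      torsion_coboundary J (x - y)].
Proof.
move=> Jx dx; have := mul_torsion_coboundary Jx dx.
case: n x Jx dx => [|n] x Jx dx /=.
  move=> ux; exists x; rewrite subrr; split=> //.
  by apply/torsion_add_principal => //; split=> //; exists 1%N.
move=> [w Jw dw].
have [v Jv vw] := torsion_divisible noethA (@res_injective _ _ E n) idJ ureg Jw.
exists (x - cdiff E n v); split.
- apply/torsion_add_principal => //; split.
    rewrite -scaleN1r addrC; apply: torsion_subproof => //.
    exact: torsion_map.
  by exists 1%N; rewrite expr1 scalerBr -linearZ_LR /= vw dw subrr.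
- by rewrite linearB /= cdiffK dx subr0.
- by exists v => //; rewrite opprB addrC subrK.
Qed.

(** Injectivity of the same map. If [x = d w] and [u ^+ k] kills [x], then [u ^+ k *: w] is a
    cocycle, so [u ^+ k.+1 *: w = d v]. Dividing [v = u ^+ k.+1 *: t] yields the primitive
    [w - d t], killed by [u ^+ k.+1]. *)
Lemma torsion_add_coboundary n (x : E n) :
  torsion K (E n) x -> torsion_coboundary J x -> torsion_coboundary K x.
Proof.
case: n x => [//|n] x Kx /= [w Jw dw].
have [_ [k ukx]] := (torsion_add_principal u x noethA idJ).1 Kx.
have Juw : torsion J (E n) (u ^+ k *: w).
  by rewrite -[_ *: _]addr0; apply: torsion_subproof => //; apply: torsion0.
have duw : cdiff E n (u ^+ k *: w) = 0 by rewrite linearZ_LR /= dw ukx.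
have := mul_torsion_coboundary Juw duw; rewrite scalerA -exprS.
case: n x w Kx Jw dw ukx {Juw duw} => [|n] x w Kx Jw dw ukx /=.
  move=> uw; exists w => //; apply/torsion_add_principal => //.
  by split=> //; exists k.+1.
move=> [v Jv dv].
have [t Jt tv] := torsion_divisible noethA (@res_injective _ _ E n) idJ
  (@lregX _ u k.+1 ureg) Jv.
exists (w - cdiff E n t); last by rewrite linearB /= cdiffK subr0.
apply/torsion_add_principal => //; split.
  rewrite -scaleN1r addrC; apply: torsion_subproof => //.
  exact: torsion_map.
by exists k.+1; rewrite scalerBr -linearZ_LR /= tv dv subrr.
Qed.

End Multiplication.

(** * Restriction of scalars along a finite free extension *)

Section RestrictionOfScalars.
Variables (A B : comNzRingType) (h : {rmorphism A -> B}).

Definition restriction (M : lmodType B) : Type := M.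

Section Module.
Variable M : lmodType B.

HB.instance Definition _ := GRing.Zmodule.on (restriction M).

Definition restr_scale (a : A) (x : restriction M) : restriction M :=
  h a *: (x : M).

Fact restr_scaleA a b x : restr_scale a (restr_scale b x) = restr_scale (a * b) x.
Proof. by rewrite /restr_scale scalerA rmorphM. Qed.

Fact restr_scale1 : left_id 1 restr_scale.
Proof. by move=> x; rewrite /restr_scale rmorph1 scale1r. Qed.

Fact restr_scaleDr : right_distributive restr_scale +%R.
Proof. by move=> a x y; apply: scalerDr. Qed.

Fact restr_scaleDl x : {morph restr_scale^~ x : a b / a + b}.
Proof. by move=> a b; rewrite /restr_scale rmorphD scalerDl. Qed.

HB.instance Definition _ := GRing.Zmodule_isLmodule.Build A (restriction M)
  restr_scaleA restr_scale1 restr_scaleDr restr_scaleDl.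

Lemma restr_scaleE a (x : restriction M) : a *: x = h a *: (x : M) :> M.
Proof. by []. Qed.

(** Independence of base: the annihilator over [A] is the preimage of the one over [B], and torsion
    only sees radicals. *)
Lemma torsion_restriction (I : set A) (x : M) :
  noetherian A -> noetherian B -> is_ideal I ->
  torsion I (restriction M) x <-> torsion (ideal_gen [set h a | a in I]) M x.
Proof.
move=> noethA noethB idI; rewrite !torsionP //; last exact: ideal_gen_is_ideal.
have annE a k : ann (x : restriction M) (a ^+ k) = ann x (h a ^+ k).
  by rewrite -rmorphXn.
split=> [Ix|Jx a Ia].
  apply: ideal_gen_sub; first exact/radical_ideal/ann_ideal.
  by move=> _ [a /Ix[k ax] <-]; exists k; rewrite -annE.
have [|k] := Jx (h a); first by apply: sub_ideal_gen; exists a.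
by rewrite -annE; exists k.
Qed.

End Module.

Section Linear.
Variables (M N : lmodType B) (f : {linear M -> N}).

Fact restr_linear_subproof : linear (f : restriction M -> restriction N).
Proof. by move=> a x y; apply: linearP. Qed.

Definition restr_linear : {linear restriction M -> restriction N} :=
  mk_linear restr_linear_subproof.

End Linear.

Fact restr_cx_subproof (K : cochain_complex B) n (x : restriction (K n)) :
  restr_linear (cdiff K n.+1) (restr_linear (cdiff K n) x) = 0.
Proof. exact: cdiffK. Qed.

Definition restr_cx (K : cochain_complex B) : cochain_complex A :=
  CochainComplex (@restr_cx_subproof K).

Lemma torsion_coboundary_restr (I : set A) (K : cochain_complex B) n (x : K n) :
  noetherian A -> noetherian B -> is_ideal I ->
  @torsion_coboundary A I (restr_cx K) n x <->
  torsion_coboundary (ideal_gen [set h a | a in I]) x.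
Proof.
move=> noethA noethB idI; case: n x => [//|n] x.
by split=> -[w Iw <-]; exists w => //; apply/torsion_restriction.
Qed.

(** [coordP] is [A]-linearity written through [h], since [B] is given only as a ring. *)
Record free_basis : Type := FreeBasis {
  rank : nat;
  basis : 'I_rank -> B;
  coord : 'I_rank -> B -> A;
  coordP : forall k a s t, coord k (h a * s + t) = a * coord k s + coord k t;
  coordK : forall s, \sum_k h (coord k s) * basis k = s;
  coord_basis : forall j k, coord k (basis j) = (j == k)%:R }.

Arguments coord : clear implicits.
Arguments basis : clear implicits.

Section BaseChange.
Variable b : free_basis.

Lemma coord0 k : coord b k 0 = 0.
Proof. by apply/(addrI (1 * coord b k 0)); rewrite -coordP mul1r mulr0 !addr0. Qed.

Lemma coordD k s t : coord b k (s + t) = coord b k s + coord b k t.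
Proof. by have := coordP k 1 s t; rewrite rmorph1 !mul1r. Qed.

Lemma coordZ k a s : coord b k (h a * s) = a * coord b k s.
Proof. by have := coordP k a s 0; rewrite coord0 !addr0. Qed.

Lemma coord_sum k I (r : seq I) (P : pred I) (F : I -> B) :
  coord b k (\sum_(i <- r | P i) F i) = \sum_(i <- r | P i) coord b k (F i).
Proof. exact: (big_morph (coord b k) (coordD k) (coord0 k)). Qed.

(* [B \otimes_A V], with [B] acting through the matrices of multiplication. *)
Definition base_change (V : lmodType A) : Type := {ffun 'I_(rank b) -> V}.

Section Module.
Variable V : lmodType A.

HB.instance Definition _ := GRing.Zmodule.on (base_change V).

Definition bc_scale (s : B) (v : base_change V) : base_change V :=
  [ffun k => \sum_j coord b k (s * basis b j) *: v j].

Fact bc_scaleA s t v : bc_scale s (bc_scale t v) = bc_scale (s * t) v.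
Proof.
apply/ffunP => k; rewrite !ffunE.
under eq_bigr => j _ do rewrite ffunE scaler_sumr.
rewrite exchange_big /=; apply: eq_bigr => j _.
rewrite -mulrA -{2}[t * _](coordK b) mulr_sumr coord_sum scaler_suml.
by apply: eq_bigr => l _; rewrite scalerA mulrCA coordZ mulrC.
Qed.

Fact bc_scale1 : left_id 1 bc_scale.
Proof.
move=> v; apply/ffunP => k; rewrite ffunE (bigD1 k) //= big1 => [|j jk].
  by rewrite mul1r coord_basis eqxx scale1r addr0.
by rewrite mul1r coord_basis (negPf jk) scale0r.
Qed.

Fact bc_scaleDr : right_distributive bc_scale +%R.
Proof.
move=> s v w; apply/ffunP => k; rewrite !ffunE -big_split.
by apply: eq_bigr => j _; rewrite ffunE scalerDr.
Qed.

Fact bc_scaleDl v : {morph bc_scale^~ v : s t / s + t}.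
Proof.
move=> s t; apply/ffunP => k; rewrite !ffunE -big_split.
by apply: eq_bigr => j _; rewrite mulrDl coordD scalerDl.
Qed.

HB.instance Definition _ := GRing.Zmodule_isLmodule.Build B (base_change V)
  bc_scaleA bc_scale1 bc_scaleDr bc_scaleDl.

End Module.

(* The unit [y |-> 1 \otimes y]. *)
Definition bc_unit (V : lmodType A) (y : V) : base_change V :=
  [ffun k => coord b k 1 *: y].

(** Restriction is right adjoint to base change, which preserves injections because it acts
    coordinatewise. So [g] is transposed to a [B]-linear map on [base_change V], extended to
    [base_change W], and transposed back along the unit. *)
Lemma restriction_injective (E : lmodType B) :
  injective_module E -> injective_module (restriction E).
Proof.
move=> injE V W f g f_inj.
have lin_bf : linear (fun v : base_change V => [ffun k => f (v k)] : base_change W).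
  move=> s v w; apply/ffunP => k; rewrite !ffunE linearD linear_sum; congr (_ + _).
  by apply: eq_bigr => j _; rewrite ffunE linearZ_LR.
(* The transpose of [g], sending [basis b k \otimes v] to [basis b k *: g v]. *)
have lin_bg : linear (fun v : base_change V => \sum_k basis b k *: (g (v k) : E)).
  move=> s v w; rewrite scaler_sumr.
  under eq_bigr => k _ do rewrite !ffunE linearD scalerDr.
  rewrite big_split /=; congr (_ + _).
  under eq_bigr => k _ do rewrite linear_sum scaler_sumr.
  rewrite exchange_big; apply: eq_bigr => j _ /=.
  rewrite scalerA -[in RHS](coordK b (s * _)) scaler_suml; apply: eq_bigr => k _.
  by rewrite linearZ_LR restr_scaleE scalerA mulrC.
have [v w /ffunP fvw|H HE] := injE _ _ (mk_linear lin_bf) (mk_linear lin_bg).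
  by apply: (iffLR (ffunP v w)) => k; apply: f_inj; have := fvw k; rewrite !ffunE.
(* This rests on [bc_unit (a *: y) = h a *: bc_unit y], checked through the coordinates of [1],
   which need not be a basis vector. *)
have lin_H : linear (fun y => H (bc_unit y) : restriction E).
  move=> a y z; rewrite [RHS]/GRing.add /= -[RHS]linearP; congr (H _).
  apply/ffunP => k; rewrite !ffunE scalerDr; congr (_ + _).
  under eq_bigr => j _ do rewrite ffunE scalerA coordZ -mulrA.
  rewrite -scaler_suml scalerA; congr (_ *: _).
  rewrite -mulr_sumr mulrC; congr (_ * _).
  rewrite -{1}(coordK b 1) coord_sum; apply: eq_bigr => j _.
  by rewrite coordZ mulrC.
exists (mk_linear lin_H) => x.
rewrite /= (_ : bc_unit _ = mk_linear lin_bf (bc_unit x)).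
  rewrite HE /=; under eq_bigr => k _.
    rewrite ffunE linearZ_LR restr_scaleE scalerA mulrC; over.
  by rewrite -scaler_suml coordK scale1r.
by apply/ffunP => k; rewrite !ffunE linearZ_LR.
Qed.

Section Resolution.
Variables (N : lmodType B) (E : injective_resolution N).

Fact restr_aug_inj : injective (restr_linear (res_aug E)).
Proof. exact: res_aug_inj. Qed.

Fact restr_exact0 (x : restr_cx E 0) :
  cdiff (restr_cx E) 0 x = 0 -> exists y, restr_linear (res_aug E) y = x.
Proof. exact: res_exact0. Qed.

Fact restr_augK y : cdiff (restr_cx E) 0 (restr_linear (res_aug E) y) = 0.
Proof. exact: res_augK. Qed.

Fact restr_exact n (x : restr_cx E n.+1) :
  cdiff (restr_cx E) n.+1 x = 0 -> exists y, cdiff (restr_cx E) n y = x.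
Proof. exact: res_exact. Qed.

Fact restr_cx_injective n : injective_module (restr_cx E n).
Proof. exact/restriction_injective/res_injective. Qed.

Definition restr_resolution : injective_resolution (restriction N) :=
  @InjectiveResolution A _ (restr_cx E) (restr_linear (res_aug E)) restr_aug_inj
    restr_exact0 restr_augK restr_exact restr_cx_injective.

End Resolution.

(** Coordinates and basis give [A]-linear maps [B -> A] and [A -> B], with lifts [alpha k] and
    [beta k] to resolutions. Then [x] is cohomologous to [\sum_k beta k (alpha k x)], and the
    hypothesis over [A] applies to each [alpha k x]. *)
Lemma free_torsion_coboundary (I : set A) (ER : injective_resolution A^o)
    (E : injective_resolution B^o) (u : A) n :
  noetherian A -> noetherian B -> is_ideal I ->
  (forall x : ER n, torsion I (ER n) x -> cdiff ER n x = 0 ->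
     torsion_coboundary I (u *: x) -> torsion_coboundary I x) ->
  forall x : E n, torsion (ideal_gen [set h a | a in I]) (E n) x ->
    cdiff E n x = 0 ->
    torsion_coboundary (ideal_gen [set h a | a in I]) (h u *: x) ->
    torsion_coboundary (ideal_gen [set h a | a in I]) x.
Proof.
move=> noethA noethB idI u_reg x /torsion_restriction Ix dx.
move=> /torsion_coboundary_restr ux; apply/torsion_coboundary_restr => //.
have {}Ix := Ix noethA noethB idI; have {}ux := ux noethA noethB idI.
set F := restr_resolution E.
have lin_coord k : linear (coord b k : restriction B^o -> A^o).
  by move=> a s t; apply: coordP.
have lin_basis k : linear (fun a : A^o => h a * basis b k : restriction B^o).
  by move=> a s t; rewrite rmorphD rmorphM mulrDl -mulrA.
pose alpha k := sval (cid (lift_exists (mk_linear (lin_coord k)) F ER)).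
have alphaP k : lifts (mk_linear (lin_coord k)) (alpha k).
  by rewrite /alpha; case: cid.
pose beta k := sval (cid (lift_exists (mk_linear (lin_basis k)) ER F)).
have betaP k : lifts (mk_linear (lin_basis k)) (beta k).
  by rewrite /beta; case: cid.
(* The sum of the [beta k \o alpha k] minus the identity lifts zero by [coordK], so it is
   null-homotopic. *)
have lin_phi l : linear (fun y : F l => \sum_k beta k l (alpha k l y) - y).
  move=> a y z; rewrite scalerBr scaler_sumr addrACA -opprD; congr (_ - _).
  by rewrite -big_split; apply: eq_bigr => k _; rewrite !linearP.
have phiD l (y : F l) : mk_linear (lin_phi l.+1) (cdiff F l y) =
    cdiff F l (mk_linear (lin_phi l) y).
  rewrite /= linearB linear_sum; congr (_ - _).
  by apply: eq_bigr => k _; rewrite !cmapD.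
pose phi := CochainMap phiD.
have : torsion_coboundary I (phi n x).
  apply: null_coboundary => // s.
  rewrite [LHS]/=; under eq_bigr => k _ do rewrite alphaP betaP.
  rewrite -linear_sum -linearB -[RHS](linear0 (res_aug F)); congr (res_aug F _).
  by rewrite /= [X in X - _]coordK subrr.
have : torsion_coboundary I (\sum_k beta k n (alpha k n x)).
  apply: (big_ind (@torsion_coboundary A I F n)).
  - by case: (n) => [//|l]; exists 0; [apply: torsion0 | rewrite linear0].
  - by move=> y z; rewrite -[y in y + z]scale1r; apply: torsion_coboundaryD.
  move=> k _; apply/torsion_coboundary_map/u_reg.
  - exact: torsion_map.
  - by rewrite -cmapD /= dx linear0.
  - by rewrite -linearZ_LR; apply: torsion_coboundary_map.
move=> cs cphi; have := torsion_coboundaryD (-1) cphi cs.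
by rewrite scaleN1r /= opprB subrK.
Qed.

End BaseChange.
End RestrictionOfScalars.

Arguments coord {A B h}.
Arguments basis {A B h}.

(** * The power basis of a quotient of a polynomial ring *)

Section QuotientPolynomials.
Variables (A : comNzRingType) (f : {poly A}).

(** [mk_monic f] is [f] when [f] is monic of positive degree and defaults to ['X] otherwise;
    elements of [{poly %/ f}] are the reduced representatives, of size at most [d]. *)
Local Notation d := (size (mk_monic f)).-1.

Lemma in_qpolyK (s : {poly %/ f}) : in_qpoly f s = s.
Proof. exact/val_inj/in_qpoly_small/size_mk_monic. Qed.

Lemma mul_qpolyC a (s : {poly %/ f}) : qpolyC f a * s = a *: s.
Proof.
rewrite -(in_qpolyK (qpolyC f a)) -[X in _ * X]in_qpolyK -in_qpolyM qpolyCE.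
by rewrite mul_polyC in_qpolyZ in_qpolyK.
Qed.

Fact qpoly_coordP (k : 'I_d) a (s t : {poly %/ f}) :
  (qpolyC f a * s + t)`_k = a * s`_k + t`_k.
Proof. by rewrite mul_qpolyC coefD coefZ. Qed.

Fact qpoly_coordK (s : {poly %/ f}) :
  \sum_(k < d) qpolyC f s`_k * in_qpoly f 'X^k = s.
Proof.
rewrite -[RHS]in_qpolyK [in RHS](_ : (s : {poly A}) = \sum_(k < d) s`_k *: 'X^k).
  by rewrite linear_sum; apply: eq_bigr => k _ /=; rewrite mul_qpolyC in_qpolyZ.
rewrite -(poly_def d); apply/polyP => k; rewrite coef_poly.
case: ltnP => // dk; apply: nth_default.
exact: leq_trans (size_npoly s) dk.
Qed.

Fact qpoly_coord_basis (j k : 'I_d) : (in_qpoly f 'X^j)`_k = (j == k)%:R.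
Proof.
rewrite in_qpoly_small ?coefXn 1?eq_sym // size_polyXn.
by rewrite -ltn_predRL.
Qed.

Definition qpoly_free_basis : free_basis (qpolyC f) :=
  FreeBasis qpoly_coordP qpoly_coordK qpoly_coord_basis.

End QuotientPolynomials.

(** * The Bockstein homomorphism *)

(** A nonzero [x] killed by [p] has annihilator exactly [pZ p]: by Bezout, an integer prime to [p]
    that kills [x] would force [x = 0]. *)
Lemma notin_AssZ_regular (M : zmodType) (p : nat) :
  prime p -> ~ AssZ M (pZ p) -> forall x : M, x *+ p = 0 -> x = 0.
Proof.
move=> p_pr nAss x px; apply: contrapT => x_neq0; apply: nAss; split.
  split=> [||k l]; rewrite /pZ /=.
  - split=> [|a k l /= pk pl]; first exact: dvdz0.
    by rewrite rpredD // dvdz_mull.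
  - by rewrite dvdzE /= dvdn1 => /eqP p1; rewrite p1 in p_pr.
  - by rewrite !dvdzE abszM Euclid_dvdM // => /orP.
exists x; apply/seteqP; split=> k /=.
  by case/dvdzP=> q ->; rewrite mulrC mulrzA -pmulrn px mul0rz.
move=> xk; apply: contrapT => /negP; rewrite dvdzE /= => npk; apply: x_neq0.
have /coprimezP[[a b] /= ab] : coprimez p k.
  by rewrite coprimezE /= prime_coprime.
have := mulr1z x; rewrite -ab mulrzDr [a * p]mulrC (mulrC b) !mulrzA -pmulrn px xk.
by rewrite !mul0rz addr0.
Qed.

(** Injectivity of [p] on [H^n_I(M)] in terms of cocycles, the form in which it is carried from [R]
    to [S]. *)
Lemma local_cohomology_regular (A : comNzRingType) (I : set A) (M : lmodType A)
    (E : injective_resolution M) n (p : nat) :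
  prime p -> ~ AssZ (local_cohomology I E n) (pZ p) ->
  forall x : E n, torsion I (E n) x -> cdiff E n x = 0 ->
  torsion_coboundary I ((p%:R : A) *: x) -> torsion_coboundary I x.
Proof.
move=> p_pr /(notin_AssZ_regular p_pr) reg x Ix dx px.
pose z : Gamma_cx I E n := in_submod (N := torsion I (E n)) Ix.
have dz : cdiff (Gamma_cx I E) n z = 0 by apply: val_inj.
have dpz : cdiff (Gamma_cx I E) n ((p%:R : A) *: z) = 0.
  by rewrite linearZ_LR dz scaler0.
apply/(coh_class_eq0 dz)/reg; rewrite -scaler_nat.
rewrite -((coh_class_eq0 dpz).2 px) /coh_class -linearZ_LR.
by congr quot_pi; apply: val_inj.
Qed.

Section Bockstein.
Variables (A : comNzRingType) (u : A) (X : bockstein_data u).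

(** Multiplication by [u] on [A] is lifted by the injective map [ses_f X 0], and the augmentation is
    injective. *)
Lemma bockstein_data_lreg : GRing.lreg u.
Proof.
move=> a b uab; apply: (@res_aug_inj _ _ (ses_left X)).
have [f_inj _ _] := ses_exact X 0; apply: f_inj.
by rewrite !(ses_f_lifts X); congr (res_aug _ _).
Qed.

Lemma mod_by_annihilated (x : mod_by u) : u *: x = 0.
Proof.
rewrite -[x]quot_reprK -linearZ_LR -[0](linear0 (mod_pi u)).
by apply/quot_piP; rewrite subr0; exists (quot_repr x).
Qed.

Lemma ses_left_cocycle n (y : ses_mid X n) (x : ses_left X n.+1) :
  ses_f X n.+1 x = cdiff _ n y -> cdiff _ n.+1 x = 0.
Proof.
move=> fx; have [f_inj _ _] := ses_exact X n.+2; apply: f_inj.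
by rewrite cmapD fx cdiffK linear0.
Qed.

(** Multiplication by [u] kills the connecting map. As the two resolutions of [A] may differ, a lift
    [g] of the identity leads back from [ses_mid] to [ses_left]: [g \o ses_f] is homotopic to [u],
    and it sends [x] to [d (g y)]. *)
Lemma ses_left_boundary (L : set A) n (y : ses_mid X n) (x : ses_left X n.+1) :
  torsion L _ y -> torsion L _ x -> ses_f X n.+1 x = cdiff _ n y ->
  torsion_coboundary L (u *: x).
Proof.
move=> Ly Lx fx.
have [g gP] := lift_exists (idfun : {linear A^o -> A^o}) (ses_mid X) (ses_left X).
have dx := ses_left_cocycle fx.
have lin_phi l : linear (fun x : ses_left X l => g l (ses_f X l x) - u *: x).
  by move=> a v w; rewrite !linearP /= scalerDr addrACA.
have phiD l (v : ses_left X l) : mk_linear (lin_phi l.+1) (cdiff _ l v) =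
    cdiff _ l (mk_linear (lin_phi l) v).
  by rewrite [RHS]linearB linearZ_LR /= !cmapD.
pose phi := CochainMap phiD.
have cphi : torsion_coboundary L (phi n.+1 x).
  apply: null_coboundary => // a.
  by rewrite /= (ses_f_lifts X) gP /= -linearZ_LR subrr.
have cgy : torsion_coboundary L (g n.+1 (ses_f X n.+1 x)).
  by exists (g n y); [apply: torsion_map | rewrite fx cmapD].
have := torsion_coboundaryD (-1) cphi cgy.
by rewrite scaleN1r /= opprB subrK.
Qed.

(** The Bockstein class is computed from a triple [z1], [y], [x] that is torsion for [K], hence for
    both [J] and [L]. Over [L] the hypothesis makes [x] a coboundary, and its image in the
    resolution of [A/uA] is brought back to [J] through [K']. *)
Lemma bockstein_eq0 (J L : set A) n :
  noetherian A -> is_ideal J -> is_ideal L ->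
  radical (ideal_add J (ideal_gen [set u])) =
  radical (ideal_add L (ideal_gen [set u])) ->
  (forall x : ses_left X n, torsion L _ x -> cdiff (ses_left X) n x = 0 ->
     torsion_coboundary L (u *: x) -> torsion_coboundary L x) ->
  forall z, bockstein J X n z = 0.
Proof.
move=> noethA idJ idL JL u_reg; case: n u_reg => [//|n] u_reg z.
have ureg := bockstein_data_lreg; have uN := mod_by_annihilated.
have [z0 [dz0 ->]] := coh_classP z.
have [dz0' Jz0] := (congr1 val dz0, submodP z0).
have [z1 [Kz1 dz1 cz1]] := torsion_add_cocycle noethA idJ ureg uN Jz0 dz0'.
set K := ideal_add J _ in Kz1; set K' := ideal_add L (ideal_gen [set u]).
have idK : is_ideal K by apply: ideal_gen_is_ideal.
have idK' : is_ideal K' by apply: ideal_gen_is_ideal.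
have KK' (M : lmodType A) (x : M) : torsion K M x -> torsion K' M x.
  exact: torsion_radical_eq.
have K'K (M : lmodType A) (x : M) : torsion K' M x -> torsion K M x.
  exact: torsion_radical_eq.
have KJ (M : lmodType A) (x : M) : torsion K M x -> torsion J M x.
  by case/torsion_add_principal.
have K'L (M : lmodType A) (x : M) : torsion K' M x -> torsion L M x.
  by case/torsion_add_principal.
have [_ gS _] := Gamma_ses_exact K X n.
have [y gy] := gS (in_submod (N := torsion K _) Kz1).
have [_ _ gE] := Gamma_ses_exact K X n.+1.
have /gE[x fx] : Gamma_cmap K (ses_g X) n.+1 (cdiff (Gamma_cx K _) n y) = 0.
  by rewrite cmapD gy; apply: val_inj.
have Ky : torsion K _ (val y) := submodP y.
have Kx : torsion K _ (val x) := submodP x.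
have {}gy : ses_g X n (val y) = z1 := congr1 val gy.
have {}fx : ses_f X n.+1 (val x) = cdiff _ n (val y) := congr1 val fx.
have dx := ses_left_cocycle fx.
(* The class of [x] is a value of the connecting map over [L], hence killed by [u]. *)
have cx : torsion_coboundary L (val x).
  apply: u_reg => //; first exact/K'L/KK'.
  by apply: ses_left_boundary fx; apply/K'L/KK'.
(* Passing from [L] to [K'] is possible after [bock_lift], whose target resolves a module killed by
   [u]. *)
have {}cx : torsion_coboundary J (bock_lift X n.+1 (val x)).
  apply: (@torsion_coboundary_sub _ K') => [k v /K'K/KJ//|].
  apply: torsion_add_coboundary => //; first exact/torsion_map/KK'.
  exact: torsion_coboundary_map.
(* The same triple, viewed in [Gamma_J], computes the connecting map there. *)
pose w : Gamma_cx J _ n := in_submod (N := torsion J _) (KJ _ _ Kz1).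
have dw : cdiff (Gamma_cx J _) n w = 0 by apply: val_inj.
have -> : coh_class dz0 = coh_class dw by apply: coh_class_eq.
pose y' : Gamma_cx J _ n := in_submod (N := torsion J _) (KJ _ _ Ky).
pose x' : Gamma_cx J _ n.+1 := in_submod (N := torsion J _) (KJ _ _ Kx).
have dx' : cdiff (Gamma_cx J _) n.+1 x' = 0 by apply: val_inj.
rewrite /= (@connecting_funE _ _ _ _ _ _ (Gamma_ses_exact J X) _ _ dw y' x' dx');
  [|exact: val_inj..].
have dphix : cdiff (Gamma_cx J _) n.+1 (Gamma_cmap J (bock_lift X) n.+1 x') = 0.
  by rewrite -cmapD dx' linear0.
rewrite [LHS](coh_map_class dx' dphix); exact: (coh_class_eq0 dphix).2 cx.
Qed.

End Bockstein.

Theorem theorem3p1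
  (R : comNzRingType) (m : set R) (p : nat)
  (R_regular : regular_local m) (R_unramified : unramified m p)
  (f : {poly R}) (f_eisenstein : eisenstein m f)
  (n : set {poly %/ f})
  (S_regular : regular_local n) (S_ramified : ramified n p)
  (I : set R) (I_ideal : is_ideal I) (i : nat)
  (ER : injective_resolution R^o)
  (p_notin_Ass : ~ (AssZ (local_cohomology I ER i) `|`
                    AssZ (local_cohomology I ER i.+1)) (pZ p))
  (J : set {poly %/ f}) (J_ideal : is_ideal J)
  (rad_eq : radical (ideal_add J (ideal_gen [set p%:R])) =
            radical (ideal_add (ideal_extension f I) (ideal_gen [set p%:R])))
  (X : bockstein_data (p%:R : {poly %/ f})) :
  forall z : local_cohomology_pred J (ses_right X) i, bockstein J X i z = 0.
Proof.
have [noethR _ _] := R_regular; have [noethS _ _] := S_regular.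
have [[_ p_pr _] _] := R_unramified.
move=> z; apply: bockstein_eq0 rad_eq _ z => //; first exact: ideal_gen_is_ideal.
(* With [L] the extension of [I], injectivity of [p] in degree [i] is transported from [R] to [S] by
   the power basis. *)
move=> x Jx dx px; apply: (free_torsion_coboundary (qpoly_free_basis f)
  (I := I) (u := p%:R) (ER := ER)) => //; last by rewrite rmorph_nat.
by apply: local_cohomology_regular => // pAss; apply: p_notin_Ass; left.
Qed.
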